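(* Let $s\ge1$ and let $\vec M=(M_1,\dots,M_n)$ be any vector of positive integers with $2M_i+1\equiv0\pmod{p^s}$ for all $i$. Then for every $t=1,\dots,s$ one has $\mathcal M^t_{p^s}(\vec M)=\mathcal M^t_{p^s}$. In particular the filtration $0=\mathcal M^0_{p^s}(\vec M)\subset\mathcal M^1_{p^s}(\vec M)\subset\dots\subset\mathcal M^s_{p^s}(\vec M)$ does not depend on the choice of $\vec M$ and coincides with the filtration $0=\mathcal M^0_{p^s}\subset\dots\subset\mathcal M^s_{p^s}=\mathcal M_{p^s}$.
   Context: Let $p$ be an odd prime, $g\ge1$, $n=2g+1$, with $p>n$; $z=(z_1,\dots,z_n)$; $\pi_s$ denotes reduction modulo $p^s$ on $\mathbb Z[z]^n$. Quasi-constants: $f\in\mathbb Z[z]$ is a quasi-constant modulo $p^r$ if $\partial f/\partial z_i\in p^r\mathbb Z[z]$ for all $i$; these form a ring $\mathbb Z[z]_{p^r}$. For a positive integer $r$ put $M_r=(p^r-1)/2$, $\Phi_{p^r}(x,z)=\prod_{i=1}^n(x-z_i)^{M_r}$, expand $\Big(\frac{\Phi_{p^r}}{x-z_1},\dots,\frac{\Phi_{p^r}}{x-z_n}\Big)=\sum_iP^i_{p^r}(z)x^i$ with $P^i_{p^r}(z)\in\mathbb Z[z]^n$, and set $I^{[lp^r-1]}_{p^r}(z)=P^{lp^r-1}_{p^r}(z)$. For $1\le t\le s$ define $\mathcal M^t_{p^s}=\{\pi_s(\sum_{r=1}^t\sum_{l=1}^g c_{r,l}(z)\,p^{s-r}I^{[lp^r-1]}_{p^r}(z))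 : c_{r,l}\in\mathbb Z[z]_{p^r}\}$, $\mathcal M^0_{p^s}=0$, $\mathcal M_{p^s}=\mathcal M^s_{p^s}$. For $\vec M=(M_1,\dots,M_n)$ put $\Phi(x,z,\vec M)=\prod_{i=1}^n(x-z_i)^{M_i}$, expand $\Big(\frac{\Phi(x,z,\vec M)}{x-z_1},\dots,\frac{\Phi(x,z,\vec M)}{x-z_n}\Big)=\sum_iP^i(z,\vec M)x^i$, and set $I^{[m-1]}(z,\vec M)=P^{m-1}(z,\vec M)$. For $1\le t\le s$ define $\mathcal M^t_{p^s}(\vec M)=\{\pi_s(\sum_{r=1}^t\sum_{l\ge1}c_{r,l}(z)\,p^{s-r}I^{[lp^r-1]}(z,\vec M)) : c_{r,l}\in\mathbb Z[z]_{p^r}\text{, finitely many nonzero}\}$ and $\mathcal M^0_{p^s}(\vec M)=0$. *)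

(* Defs.v *)
From HB Require Import structures.
From mathcomp Require Import all_boot all_algebra.
From mathcomp Require Import mpoly.

Import GRing.Theory.
Local Open Scope ring_scope.

Definition quasi_const (n p r : nat) (f : {mpoly int[n]}) : Prop :=
  forall i : 'I_n, exists h : {mpoly int[n]}, mderiv i f = (p ^ r)%N%:R * h.

(* Phi(x,z,M) / (x - z_j) as a polynomial in x over Z[z]. *)
Definition Phi_quot (n : nat) (M : 'I_n -> nat) (j : 'I_n) : {poly {mpoly int[n]}} :=
  ('X - ('X_j)%:P) ^+ (M j).-1 * \prod_(i < n | i != j) ('X - ('X_i)%:P) ^+ M i.

Definition Ivec (n : nat) (M : 'I_n -> nat) (k : nat) (j : 'I_n) : {mpoly int[n]} :=
  (Phi_quot n M j)`_k.

Definition Mr (p r : nat) : nat := ((p ^ r).-1)./2.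

Definition Ipr (n p r l : nat) (j : 'I_n) : {mpoly int[n]} :=
  Ivec n (fun _ : 'I_n => Mr p r) (l * p ^ r).-1 j.

Definition red (n q : nat) (f : {mpoly int[n]}) : {mpoly 'Z_q[n]} :=
  map_mpoly (fun a : int => a%:~R) f.

Definition Mfilt (n g p s t : nat) (v : {ffun 'I_n -> {mpoly 'Z_(p ^ s)[n]}}) : Prop :=
  exists c : nat -> nat -> {mpoly int[n]},
    (forall r l, (1 <= r <= t)%N -> (1 <= l <= g)%N -> quasi_const n p r (c r l)) /\
    v = [ffun j => red n (p ^ s)
           (\sum_(1 <= r < t.+1) \sum_(1 <= l < g.+1)
               c r l * (p ^ (s - r))%N%:R * Ipr n p r l j)].

(* membership in M^t_{p^s}(M) : sum over l >= 1 with finitely many nonzero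
   c_{r,l}, i.e. l ranging over 1..L for some L. *)
Definition MfiltM (n p s : nat) (M : 'I_n -> nat) (t : nat)
    (v : {ffun 'I_n -> {mpoly 'Z_(p ^ s)[n]}}) : Prop :=
  exists (L : nat) (c : nat -> nat -> {mpoly int[n]}),
    (forall r l, (1 <= r <= t)%N -> (1 <= l <= L)%N -> quasi_const n p r (c r l)) /\
    v = [ffun j => red n (p ^ s)
           (\sum_(1 <= r < t.+1) \sum_(1 <= l < L.+1)
               c r l * (p ^ (s - r))%N%:R * Ivec n M (l * p ^ r).-1 j)].

(* Main.v *)
(* For r <= s the hypothesis on M gives M_i = M_r + p^r k_i with k_i >= 0, so
   Phi(x,z,M)/(x - z_j) = Phi_{p^r}/(x - z_j) * W with W = prod (x - z_i)^(p^r k_i).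
   Since W is a p^r-th power, p^(s-r) W_m = p^(s-v) H with p^v | m, v <= r and H a
   quasi-constant modulo p^v.  Comparing coefficients of x^(l p^r - 1), p^(s-r)
   I^[l p^r - 1](M) becomes a combination of terms p^(s-v) H P_{p^r}^(l' p^v - 1);
   those with v < r are again of the original form at level v, for the exponents
   M_r = M_v modulo p^v, which gives one inclusion by induction on r.  For the
   other one, W is monic, so the top term of the same product expresses
   p^(s-v) P_{p^r}^(l p^v - 1) through I(M) and coefficients of higher index, and
   one descends on the index. *)

Require Import Defs.
From HB Require Import structures.
From mathcomp Require Import all_boot all_algebra.
From mathcomp Require Import mpoly zify ring.

Import GRing.Theory.

Set Implicit Arguments.
Unset Strict Implicit.
Unset Printing Implicit Defensive.

(** * The rings of quasi-constants *)

Section QuasiConstants.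
Local Open Scope ring_scope.
Variables n p : nat.
Implicit Types f h : {mpoly int[n]}.

Lemma quasi_const0 r : quasi_const n p r 0.
Proof. by move=> i; exists 0; rewrite mderiv0 mulr0. Qed.

Lemma quasi_constD r f h :
  quasi_const n p r f -> quasi_const n p r h -> quasi_const n p r (f + h).
Proof.
move=> qf qh i; have [a ea] := qf i; have [b eb] := qh i.
by exists (a + b); rewrite mderivD ea eb mulrDr.
Qed.

Lemma quasi_constN r f : quasi_const n p r f -> quasi_const n p r (- f).
Proof.
by move=> qf i; have [a ea] := qf i; exists (- a); rewrite mderivN ea mulrN.
Qed.

Lemma quasi_constM r f h :
  quasi_const n p r f -> quasi_const n p r h -> quasi_const n p r (f * h).
Proof.
move=> qf qh i; have [a ea] := qf i; have [b eb] := qh i.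
by exists (a * h + f * b); rewrite mderivM ea eb; ring.
Qed.

Lemma quasi_const_leq v r f :
  (v <= r)%N -> quasi_const n p r f -> quasi_const n p v f.
Proof.
move=> le_vr qf i; have [a ea] := qf i; exists ((p ^ (r - v))%N%:R * a).
by rewrite ea mulrA -natrM -expnD subnKC.
Qed.

End QuasiConstants.

(** * Divisibility of the coefficients of a q-th power *)

Section CoefDerivations.
Local Open Scope ring_scope.
Variable n : nat.
Implicit Types V A B : {poly {mpoly int[n]}}.

(** The extension of d/dz_i to Z[z][x] that treats x as a constant. *)
Definition coef_mderiv (i : 'I_n) V : {poly {mpoly int[n]}} :=
  \poly_(k < size V) mderiv i V`_k.

Lemma coef_coef_mderiv i V k : (coef_mderiv i V)`_k = mderiv i V`_k.
Proof.
by rewrite coef_poly; case: ltnP => // le; rewrite nth_default ?mderiv0.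
Qed.

Lemma coef_mderivM i A B :
  coef_mderiv i (A * B) = coef_mderiv i A * B + A * coef_mderiv i B.
Proof.
apply/polyP => k; rewrite coef_coef_mderiv coefD !coefM raddf_sum -big_split /=.
by apply: eq_bigr => j _; rewrite mderivM !coef_coef_mderiv.
Qed.

Lemma coef_mderivX i V k :
  coef_mderiv i (V ^+ k) = k%:R * (V ^+ k.-1 * coef_mderiv i V).
Proof.
elim: k => [|k IHk].
  (* The Leibniz rule for 1 = 1 * 1 forces the derivative of 1 to vanish. *)
  rewrite expr0 mul0r; apply: (addrI (coef_mderiv i 1)).
  by rewrite addr0 -[in RHS](mulr1 1) coef_mderivM mulr1 mul1r.
rewrite exprS coef_mderivM IHk /= -[in RHS](addn1 k) natrD.
case: k {IHk} => [|k] /=; first by rewrite !expr0; ring.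
by rewrite exprS; ring.
Qed.

Lemma coef_exp_mderiv i V q k :
  exists h : {mpoly int[n]}, mderiv i (V ^+ q)`_k = q%:R * h.
Proof.
exists (V ^+ q.-1 * coef_mderiv i V)`_k.
by rewrite -coef_coef_mderiv coef_mderivX !mulr_natl coefMn.
Qed.

(** The left side is the coefficient of x^(k-1) in the x-derivative q V^(q-1) V' of V^q. *)
Lemma coef_exp_muln V q k :
  exists h : {mpoly int[n]}, k%:R * (V ^+ q)`_k = q%:R * h.
Proof.
case: k => [|k]; first by exists 0; rewrite mul0r mulr0.
exists (V ^+ q.-1 * V^`())`_k.
by rewrite mulr_natl -coef_deriv deriv_exp mulr_natl -coefMn mulrC.
Qed.

Lemma mpoly_natf_inj k (f h : {mpoly int[n]}) :
  (0 < k)%N -> k%:R * f = k%:R * h -> f = h.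
Proof.
move=> k_gt0; apply: mulfI.
by rewrite -(rmorph_nat (@mpolyC n int)) mpolyC_eq0 Num.Theory.pnatr_eq0 -lt0n.
Qed.

(* The coefficients of W = V^(p^r) satisfy p^r | m W_m and p^r | dW_m/dz_i.
   With p^v = gcd(p^r, m), the first divisibility gives W_m = p^(r-v) H, and
   the second one then says that H is a quasi-constant modulo p^v. *)
Lemma coef_exp_quasi_const p r s V m : prime p -> (r <= s)%N ->
  exists v (H : {mpoly int[n]}), [/\ (v <= r)%N, (p ^ v %| m)%N,
    quasi_const n p v H &
    (p ^ (s - r))%N%:R * (V ^+ (p ^ r))`_m = (p ^ (s - v))%N%:R * H].
Proof.
move=> p_pr le_rs; set w := (V ^+ _)`_m.
have p_gt0 := prime_gt0 p_pr.
have [v le_vr gcdE] := dvdn_pfactor _ r p_pr (dvdn_gcdl (p ^ r) m).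
have dvm : (p ^ v %| m)%N by rewrite -gcdE dvdn_gcdr.
have [a ea] := coef_exp_muln V (p ^ r) m.
have prE : (p ^ r = p ^ (r - v) * p ^ v)%N by rewrite -expnD subnK.
have [H wE] : exists H, w = (p ^ (r - v))%N%:R * H.
  (* Bezout: km p^r = kr m + p^v. Multiplying by w and using m w = p^r a gives p^v w = p^r (km w -
     kr a), and p^v cancels. *)
  have [|km kr eqk _] := @egcdnP (p ^ r) m; first by rewrite expn_gt0 p_gt0.
  exists (km%:R * w - kr%:R * a); apply: (@mpoly_natf_inj (p ^ v)).
    by rewrite expn_gt0 p_gt0.
  rewrite mulrA -natrM mulnC -prE mulrBr (mulrCA _ kr%:R) -ea !mulrA -!natrM.
  by rewrite mulnC eqk gcdE -mulrBl natrD addrC addKr.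
exists v, H; split=> //.
  move=> i; have [b eb] := coef_exp_mderiv i V (p ^ r) m.
  exists b; apply: (@mpoly_natf_inj (p ^ (r - v))); first by rewrite expn_gt0 p_gt0.
  rewrite mulrA -natrM -prE -eb -/w wE.
  by rewrite -(rmorph_nat (@mpolyC n int)) mderiv_mulC.
by rewrite wE mulrA -natrM -expnD; congr ((p ^ _)%N%:R * _); lia.
Qed.

End CoefDerivations.

(** * Spans modulo p^s with quasi-constant coefficients *)

Section Spanned.
Local Open Scope ring_scope.
Variables n p s : nat.
Hypothesis ps_gt1 : (1 < p ^ s)%N.
Implicit Types (F : nat -> nat -> 'I_n -> {mpoly int[n]}).
Implicit Types (u : 'I_n -> {mpoly int[n]}).

Local Notation target := {ffun 'I_n -> {mpoly 'Z_(p ^ s)[n]}}.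

Definition redv u : target :=
  [ffun j => red n (p ^ s) (u j)].

(* Rewriting with [ffunE] diverges on this codomain, hence [exact:]. *)
Lemma redvP u (v : target) : (forall j, red n (p ^ s) (u j) = v j) -> redv u = v.
Proof.
by move=> uv; apply/ffunP => j; apply: etrans (uv j); exact: ffunE.
Qed.

Lemma redvE u j : redv u j = red n (p ^ s) (u j).
Proof. exact: ffunE. Qed.

Lemma eq_redv u1 u2 : u1 =1 u2 -> redv u1 = redv u2.
Proof.
move=> eq_u; apply: redvP => j.
by apply: etrans (esym (redvE u2 j)); exact: congr1.
Qed.

Lemma redv0 : redv (fun=> 0) = 0.
Proof.
apply: redvP => j; transitivity (0 : {mpoly 'Z_(p ^ s)[n]}).
  exact: rmorph0.
by symmetry; exact: ffunE.
Qed.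

Lemma redvD u1 u2 : redv (fun j => u1 j + u2 j) = redv u1 + redv u2.
Proof.
apply: redvP => j; transitivity (red n (p ^ s) (u1 j) + red n (p ^ s) (u2 j)).
  exact: rmorphD.
symmetry; apply: etrans (congr2 +%R (redvE u1 j) (redvE u2 j)); exact: ffunE.
Qed.

Lemma redv_sum (I : Type) (r : seq I) (P : pred I) (u : I -> 'I_n -> _) :
  redv (fun j => \sum_(i <- r | P i) u i j) = \sum_(i <- r | P i) redv (u i).
Proof.
elim: r => [|i r IHr].
  by rewrite big_nil -redv0; apply: eq_redv => j; rewrite big_nil.
rewrite big_cons -IHr; case Pi: (P i); rewrite -?redvD;
  by apply: eq_redv => j; rewrite big_cons Pi.
Qed.

(** Disposes of the terms of level 0, whose factor is p^(s-0). *)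
Lemma redv_ps u : redv (fun j => (p ^ s)%N%:R * u j) = 0.
Proof.
apply: redvP => j.
transitivity (red n (p ^ s) (p ^ s)%N%:R * red n (p ^ s) (u j)).
  exact: rmorphM.
suff -> : red n (p ^ s) (p ^ s)%N%:R = 0 by rewrite mul0r; symmetry; exact: ffunE.
transitivity ((p ^ s)%N%:R : {mpoly 'Z_(p ^ s)[n]}); first exact: rmorph_nat.
by rewrite -(rmorph_nat (@mpolyC n _)) pchar_Zp.
Qed.

(** A common form for both filtrations, with generators [F r l] and no fixed bound on l; [MfiltM] is
    literally an instance. *)
Definition spanned F t (v : target) : Prop :=
  exists (L : nat) (c : nat -> nat -> {mpoly int[n]}),
    (forall r l, (1 <= r <= t)%N -> (1 <= l <= L)%N -> quasi_const n p r (c r l)) /\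
    v = [ffun j => red n (p ^ s)
           (\sum_(1 <= r < t.+1) \sum_(1 <= l < L.+1)
               c r l * (p ^ (s - r))%N%:R * F r l j)].

(** Padding the coefficients by zero allows any longer range of l, so that two combinations can be
    added over a common one. *)
Lemma spanned_widen F t v : spanned F t v ->
  exists (L0 : nat) (c : nat -> nat -> {mpoly int[n]}),
    (forall r l, (1 <= r <= t)%N -> quasi_const n p r (c r l)) /\
    forall L, (L0 <= L)%N -> v = redv (fun j =>
       \sum_(1 <= r < t.+1) \sum_(1 <= l < L.+1)
               c r l * (p ^ (s - r))%N%:R * F r l j).
Proof.
move=> [L0 [c [qc ->]]].
exists L0, (fun r l => if (1 <= l <= L0)%N then c r l else 0); split=> [r l rt|L le].
  by case: ifP => lL; [exact: qc | exact: quasi_const0].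
apply: eq_redv => j; apply: eq_bigr => r _.
rewrite [RHS](big_cat_nat _ (n := L0.+1)) //= [X in _ + X]big_nat_cond.
rewrite [X in _ + X]big1 ?addr0 => [|l /andP[/andP[lt _] _]].
  by apply: eq_big_nat => l; rewrite ltnS => ->.
by rewrite andbC leqNgt lt /= !mul0r.
Qed.

Lemma spanned0 F t : spanned F t 0.
Proof.
exists 0%N, (fun _ _ => 0); split=> [r l _ _|]; first exact: quasi_const0.
rewrite -redv0; apply: eq_redv => j.
by rewrite big1 // => r _; rewrite big1 // => l _; rewrite !mul0r.
Qed.

Lemma spannedD F t v1 v2 : spanned F t v1 -> spanned F t v2 -> spanned F t (v1 + v2).
Proof.
move=> /spanned_widen[L1 [c1 [q1 e1]]] /spanned_widen[L2 [c2 [q2 e2]]].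
exists (L1 + L2)%N, (fun r l => c1 r l + c2 r l); split=> [r l rt _|].
  by apply: quasi_constD; [exact: q1 | exact: q2].
rewrite (e1 _ (leq_addr L2 L1)) (e2 _ (leq_addl L1 L2)) -redvD.
apply: eq_redv => j; rewrite -big_split; apply: eq_bigr => r _ /=.
by rewrite -big_split; apply: eq_bigr => l _ /=; rewrite -!mulrDl.
Qed.

Lemma spanned_sum F t (I : Type) (r : seq I) (P : pred I) v :
  (forall i, P i -> spanned F t (v i)) -> spanned F t (\sum_(i <- r | P i) v i).
Proof. by move=> Fv; apply: big_ind => //; [exact: spanned0|exact: spannedD]. Qed.

Lemma spanned_gen F t r l c : (1 <= r <= t)%N -> (0 < l)%N -> quasi_const n p r c ->
  spanned F t (redv (fun j => c * (p ^ (s - r))%N%:R * F r l j)).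
Proof.
move=> /andP[r_gt0 le_rt] l_gt0 qc.
exists l, (fun r' l' => if (r' == r) && (l' == l) then c else 0); split.
  by move=> r' l' _ _; case: ifP => [/andP[/eqP-> _]|_] //; exact: quasi_const0.
apply: eq_redv => j.
rewrite (bigD1_seq r) ?iota_uniq ?mem_index_iota ?r_gt0 ?ltnS //=.
rewrite (bigD1_seq l) ?iota_uniq ?mem_index_iota ?l_gt0 ?ltnS //= !eqxx /=.
rewrite big1 ?addr0 => [|l' /negbTE->]; last by rewrite !mul0r.
rewrite big1 ?addr0 // => r' /negbTE->.
by rewrite big1 // => l' _; rewrite !mul0r.
Qed.

(** Spans are closed under addition, so an inclusion need only be tested on single generators with a
    quasi-constant factor. *)
Lemma spanned_trans F G t v :
  (forall r l c, (1 <= r <= t)%N -> (0 < l)%N -> quasi_const n p r c ->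
     spanned G t (redv (fun j => c * (p ^ (s - r))%N%:R * F r l j))) ->
  spanned F t v -> spanned G t v.
Proof.
move=> FG [L [c [qc ->]]].
(* The redundant range conditions on r and l keep the bounds available to [spanned_sum]. *)
have -> : [ffun j => red n (p ^ s) (\sum_(1 <= r < t.+1) \sum_(1 <= l < L.+1)
    c r l * (p ^ (s - r))%N%:R * F r l j)] =
  \sum_(r <- index_iota 1 t.+1 | (1 <= r < t.+1)%N)
   \sum_(l <- index_iota 1 L.+1 | (1 <= l < L.+1)%N)
    redv (fun j => c r l * (p ^ (s - r))%N%:R * F r l j).
  under [RHS]eq_bigr => r _ do rewrite -redv_sum.
  rewrite -redv_sum; apply: eq_redv => j.
  by rewrite big_nat_cond big_seq_cond [RHS]big_seq_cond; apply: eq_big => [r|r _];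
    rewrite ?mem_index_iota ?andbT ?andbb // big_nat_cond big_seq_cond
            [RHS]big_seq_cond; apply: eq_bigl => l;
    rewrite mem_index_iota andbT andbb.
apply: spanned_sum => r rt; apply: spanned_sum => l lL.
by apply: FG => //; [case/andP: lL | exact: qc].
Qed.

End Spanned.

(** * Master polynomials: factorisation, degree and comparison of spans *)

Section MasterPolynomials.
Local Open Scope ring_scope.
Variables n p s : nat.
Hypotheses (p_pr : prime p) (p_odd : odd p) (s_gt0 : (0 < s)%N).
Implicit Types (M N k : 'I_n -> nat) (c : {mpoly int[n]}).

Lemma ps_gt1 : (1 < p ^ s)%N.
Proof. by rewrite -(exp1n s) ltn_exp2r // prime_gt1. Qed.

Lemma doubleMr r : (2 * Mr p r).+1 = (p ^ r)%N.
Proof.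
have : (0 < p ^ r)%N by rewrite expn_gt0 prime_gt0.
by have := odd_double_half (p ^ r)%N; rewrite /Mr oddX p_odd orbT; lia.
Qed.

Lemma Mr_gt0 r : (0 < r)%N -> (0 < Mr p r)%N.
Proof.
move=> r_gt0; have : (1 < p ^ r)%N by rewrite -(exp1n r) ltn_exp2r // prime_gt1.
by rewrite -doubleMr; case: (Mr p r).
Qed.

(** Write 2m+1 = q p^r. Then q is odd, and q = 2e+1 together with p^r = 2 M_r + 1 gives m. *)
Lemma Mr_decomp r m : (p ^ r %| (2 * m).+1)%N -> exists e, m = (Mr p r + p ^ r * e)%N.
Proof.
case/dvdnP => q eq_q; exists q./2.
have: odd (q * p ^ r)%N by rewrite -eq_q; lia.
rewrite oddM => /andP[oddq _].
by have := odd_double_half q; have := doubleMr r; rewrite oddq; nia.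
Qed.

Lemma Mr_decomp_all r N : (forall i, p ^ r %| (2 * N i).+1)%N ->
  exists k, forall i, N i = (Mr p r + p ^ r * k i)%N.
Proof.
move=> dvdN; have ex i : exists e, N i == (Mr p r + p ^ r * e)%N.
  by have [e ->] := Mr_decomp (dvdN i); exists e.
by exists (fun i => ex_minn (ex i)) => i; case: ex_minnP => m /eqP.
Qed.

Definition Xprod k : {poly {mpoly int[n]}} :=
  \prod_(i < n) ('X - ('X_i)%:P) ^+ k i.

Lemma Xprod_monic k : Xprod k \is monic.
Proof. by apply: monic_prod => i _; rewrite monic_exp // monicXsubC. Qed.

Lemma Phi_quot_mul M N k q j : (0 < M j)%N ->
  (forall i, N i = M i + q * k i)%N ->
  Phi_quot n N j = Phi_quot n M j * Xprod k ^+ q.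
Proof.
move=> Mj_gt0 NE; rewrite /Phi_quot /Xprod -prodrXl [X in _ = _ * X](bigD1 j) //= mulrACA.
(* For the factor at j, [0 < M j] ensures (N j).-1 = (M j).-1 + q * k j. *)
congr (_ * _).
  by rewrite -exprM -exprD NE; congr (_ ^+ _); lia.
rewrite -big_split /=; apply: eq_bigr => i _.
by rewrite -exprM -exprD NE mulnC.
Qed.

Lemma IvecM M N k q i j : (0 < M j)%N ->
  (forall i, N i = M i + q * k i)%N ->
  Ivec n N i j = \sum_(m < i.+1) Ivec n M (i - m) j * (Xprod k ^+ q)`_m.
Proof. by move=> Mj NE; rewrite /Ivec (Phi_quot_mul Mj NE) coefMr. Qed.

(** A degree count: multiplying back by x - z_j shows that the quotient has degree n M_r - 1, which
    is below (g+1) p^r - 1 for n = 2g+1. *)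
Lemma Ipr_eq0 g r l j : n = (2 * g).+1 -> (0 < r)%N -> (g < l)%N -> Ipr n p r l j = 0.
Proof.
move=> nE r_gt0 lt_gl; have pr := doubleMr r; have Mr0 := Mr_gt0 r_gt0.
pose A : {poly {mpoly int[n]}} := Phi_quot n (fun=> Mr p r) j.
have AE : A * ('X - ('X_j)%:P) = (\prod_(i < n) ('X - ('X_i)%:P)) ^+ Mr p r.
  rewrite /A /Phi_quot mulrAC -exprSr prednK // -prodrXl.
  by rewrite [RHS](bigD1 j).
have A_neq0 : A != 0.
  apply/eqP => A0; move/eqP: AE.
  rewrite A0 mul0r eq_sym expf_eq0.
  by rewrite (negbTE (monic_neq0 (monic_prod_XsubC _ _ _))) andbF.
have szA : size A = (n * Mr p r)%N.
  have := congr1 (fun P : {poly _} => (size P).-1) AE.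
  rewrite /= size_exp size_prod_XsubC size_Mmonic ?monicXsubC // size_XsubC.
  by rewrite addn2 /= => ->; rewrite -sum1_size big_const_ord iter_addn_0 mul1n.
by apply: nth_default; rewrite -/A szA; nia.
Qed.

(** Both l p^r and m are multiples of p^v, so the shape of the index survives at level v; m < l p^r
    keeps l' positive. *)
Lemma dvdn_sub_index v r l m : (v <= r)%N -> (p ^ v %| m)%N -> (m < l * p ^ r)%N ->
  exists2 l', (0 < l')%N & ((l * p ^ r).-1 - m = (l' * p ^ v).-1)%N.
Proof.
move=> le_vr dvm lt_m.
have /dvdnP[l' El] : (p ^ v %| l * p ^ r - m)%N.
  by rewrite dvdn_sub // dvdn_mull // dvdn_exp2l.
exists l'; last by rewrite -El; lia.
by case: l' El => // /eqP; rewrite mul0n subn_eq0 leqNgt lt_m.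
Qed.

(** Strong induction on the level r. The vector N is generalised because the recursive calls replace
    it by the constant vector M_r. *)
Lemma spanned_Ipr r N l c t : (forall i, p ^ r %| (2 * N i).+1)%N ->
  (0 < l)%N -> (r <= t <= s)%N -> quasi_const n p r c ->
  spanned (Ipr n p) t
    (redv p s (fun j => c * (p ^ (s - r))%N%:R * Ivec n N (l * p ^ r).-1 j)).
Proof.
elim/ltn_ind: r N l c => r IH N l c dvdN l_gt0 /andP[le_rt le_ts] qc.
case: (posnP r) => [r0|r_gt0].
  rewrite (_ : redv _ _ _ = 0); first exact: spanned0.
  rewrite -(redv_ps ps_gt1 (fun j => c * Ivec n N (l * p ^ r).-1 j)).
  by apply: eq_redv => j; rewrite r0 subn0; ring.
have le_rs := leq_trans le_rt le_ts.
have [k NE] := Mr_decomp_all dvdN.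
have lp_gt0 : (0 < l * p ^ r)%N by rewrite muln_gt0 l_gt0 expn_gt0 prime_gt0.
rewrite (@eq_redv n p s _ (fun j => \sum_(m < (l * p ^ r).-1.+1)
  c * (p ^ (s - r))%N%:R * (Ivec n (fun=> Mr p r) ((l * p ^ r).-1 - m) j *
    (Xprod k ^+ (p ^ r))`_m))); last first.
  by move=> j; rewrite (IvecM (M := fun=> _) _ (Mr_gt0 r_gt0) NE) mulr_sumr.
rewrite redv_sum; apply: spanned_sum => m _.
have [v [H [le_vr dvm qH EH]]] :=
  coef_exp_quasi_const (Xprod k) m p_pr le_rs.
have lt_m : (m < l * p ^ r)%N by rewrite -[X in (_ < X)%N](prednK lp_gt0).
have [l' l'_gt0 ->] := dvdn_sub_index le_vr dvm lt_m.
rewrite (@eq_redv n p s _ (fun j => (c * H) * (p ^ (s - v))%N%:R *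
    Ivec n (fun=> Mr p r) (l' * p ^ v).-1 j)); last first.
  move=> j; transitivity (c * ((p ^ (s - r))%N%:R * (Xprod k ^+ (p ^ r))`_m) *
    Ivec n (fun=> Mr p r) (l' * p ^ v).-1 j); first by ring.
  by rewrite EH; ring.
have qcH : quasi_const n p v (c * H).
  by apply: quasi_constM => //; exact: quasi_const_leq qc.
(* For v = r the term is itself a generator; for v < r the induction applies, as p^v divides 2 M_r +
   1 = p^r. *)
move: le_vr; rewrite leq_eqVlt => /predU1P[vr|lt_vr].
  rewrite vr in qcH *.
  by apply: (@spanned_gen n p s (Ipr n p)) => //; rewrite r_gt0.
apply: IH => //; last by rewrite le_ts (leq_trans (ltnW lt_vr)).
by move=> i; rewrite doubleMr dvdn_exp2l // ltnW.
Qed.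

Lemma spanned_Ivec M r t : (forall i, p ^ r %| (2 * M i).+1)%N ->
  (0 < r <= t)%N -> (t <= s)%N ->
  forall v l c, (v <= r)%N -> (0 < l)%N -> quasi_const n p v c ->
  spanned (fun r l => Ivec n M (l * p ^ r).-1) t
    (redv p s (fun j => c * (p ^ (s - v))%N%:R *
       Ivec n (fun=> Mr p r) (l * p ^ v).-1 j)).
Proof.
move=> dvdM /andP[r_gt0 le_rt] le_ts.
have [k ME] := Mr_decomp_all dvdM.
set F := Ivec n (fun=> Mr p r); set W := Xprod k ^+ (p ^ r).
(* From index B - 1 on, all coefficients of the quotients for M_r vanish; the descent starts
   there. *)
pose B := (\max_(j < n) size (Phi_quot n (fun=> Mr p r) j)).+1.
have F0 i j : (B <= i.+1)%N -> F i j = 0.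
  rewrite ltnS => le_Bi; apply: nth_default.
  exact: leq_trans (leq_bigmax _) le_Bi.
pose D := ((size (Xprod k)).-1 * p ^ r)%N.
have szW : (size W).-1 = D by rewrite size_exp.
have WD : W`_D = 1.
  by rewrite -szW; apply/eqP; rewrite -[_ == _]/(W \is monic) monic_exp ?Xprod_monic.
have W0 m : (D < m)%N -> W`_m = 0 by rewrite -szW => lt_m; apply/nth_default/(leq_trans (leqSpred _)).
(* Descent on the index l p^v, run as induction on its distance d to B. *)
suff main d v l c : (B <= l * p ^ v + d)%N -> (v <= r)%N -> (0 < l)%N ->
    quasi_const n p v c ->
    spanned (fun r l => Ivec n M (l * p ^ r).-1) t
      (redv p s (fun j => c * (p ^ (s - v))%N%:R * F (l * p ^ v).-1 j)).
  by move=> v l c; apply: (main B); rewrite leq_addl.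
elim: d v l c => [|d IH] v l c le_B le_vr l_gt0 qc;
  have lp_gt0 : (0 < l * p ^ v)%N by rewrite muln_gt0 l_gt0 expn_gt0 prime_gt0.
  rewrite (_ : redv _ _ _ = 0); first exact: spanned0.
  rewrite -redv0; apply: eq_redv => j; rewrite F0 ?mulr0 //; lia.
case: (posnP v) => [v0|v_gt0].
  rewrite (_ : redv _ _ _ = 0); first exact: spanned0.
  rewrite -(redv_ps ps_gt1 (fun j => c * F (l * p ^ v).-1 j)).
  by apply: eq_redv => j; rewrite v0 subn0; ring.
(* With L p^v = l p^v + D, the leading term of W meets exactly the wanted coefficient, of index l
   p^v - 1. *)
pose L := (l + (size (Xprod k)).-1 * p ^ (r - v))%N.
have LE : (L * p ^ v = l * p ^ v + D)%N by rewrite mulnDl -mulnA -expnD subnK.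
have lt_D : (D < (L * p ^ v).-1.+1)%N by clear -LE lp_gt0; lia.
rewrite (@eq_redv n p s _ (fun j =>
    c * (p ^ (s - v))%N%:R * Ivec n M (L * p ^ v).-1 j +
    \sum_(m < (L * p ^ v).-1.+1 | m != Ordinal lt_D)
      (- c) * (p ^ (s - v))%N%:R * (F ((L * p ^ v).-1 - m)%N j * W`_m))); last first.
  move=> j; rewrite (IvecM (M := fun=> _) _ (Mr_gt0 r_gt0) ME) (bigD1 (Ordinal lt_D)) //= WD.
  rewrite -mulr_sumr mulr1 (_ : ((L * p ^ v).-1 - D)%N = (l * p ^ v).-1); first by rewrite -/F -/W; ring.
  by clear -LE lp_gt0; lia.
rewrite redvD; apply: spannedD.
  apply: (@spanned_gen n p s (fun r l => Ivec n M (l * p ^ r).-1)) => //.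
    by rewrite v_gt0 (leq_trans le_vr).
  by rewrite /L addn_gt0 l_gt0.
rewrite redv_sum; apply: spanned_sum => m; rewrite -val_eqE /= => neq_mD.
have [lt_Dm|le_mD] := ltnP D m.
  rewrite (_ : redv _ _ _ = 0); first exact: spanned0.
  by rewrite -redv0; apply: eq_redv => j; rewrite W0 // !mulr0.
(* Read as a p^v-th power, W yields levels w <= v against the factor p^(s-v). *)
have WE : W = (Xprod k ^+ (p ^ (r - v))) ^+ (p ^ v).
  by rewrite -exprM -expnD subnK.
have le_vs : (v <= s)%N by rewrite (leq_trans le_vr) // (leq_trans le_rt).
have [w [H [le_wv dwm qH EH]]] :=
  coef_exp_quasi_const (Xprod k ^+ (p ^ (r - v))) m p_pr le_vs.
have lt_m : (m < L * p ^ v)%N 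
  by apply: leq_ltn_trans le_mD _; clear -LE lp_gt0; lia.
have [l' l'_gt0 El'] := dvdn_sub_index le_wv dwm lt_m.
rewrite (@eq_redv n p s _ (fun j => (- c * H) * (p ^ (s - w))%N%:R *
    F (l' * p ^ w).-1 j)); last first.
  move=> j; rewrite El'.
  transitivity (- c * ((p ^ (s - v))%N%:R * W`_m) * F (l' * p ^ w).-1 j); first by ring.
  by rewrite WE EH; ring.
(* Here m < D, so l' p^w = l p^v + D - m exceeds l p^v and d drops. *)
apply: IH => //; [|exact: leq_trans le_vr|].
  have : (0 < l' * p ^ w)%N by rewrite muln_gt0 l'_gt0 expn_gt0 prime_gt0.
  by clear -El' LE le_B le_mD neq_mD; lia.
apply: quasi_constM => //; apply: quasi_constN; exact: quasi_const_leq qc.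
Qed.

Lemma spanned_Mfilt g t v : n = (2 * g).+1 ->
  spanned (Ipr n p) t v <-> Mfilt n g p s t v.
Proof.
move=> nE; split; last by move=> [c [qc ->]]; exists g, c.
move=> /spanned_widen[L0 [c [qc vE]]].
exists c; split=> [r l rt _|]; first exact: qc.
(* The range L0 + g contains 1..g, and the generators with l > g vanish. *)
apply: etrans (vE _ (leq_addr g L0)) _; apply: eq_redv => j.
rewrite big_nat_cond [RHS]big_nat_cond; apply: eq_bigr => r.
rewrite andbT => /andP[r_gt0 _].
rewrite (big_cat_nat _ (n := g.+1)) ?ltnS ?leq_addl //= [X in _ + X]big_nat_cond.
rewrite [X in _ + X]big1 ?addr0 // => l /andP[/andP[lt_gl _] _].
by rewrite (Ipr_eq0 _ nE) ?mulr0.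
Qed.

End MasterPolynomials.

Theorem theorem5p2 (p g n s : nat) (M : 'I_n -> nat) :
  prime p -> odd p -> (1 <= g)%N -> n = (2 * g).+1 -> (n < p)%N -> (1 <= s)%N ->
  (forall i, 0 < M i)%N ->
  (forall i, p ^ s %| (2 * M i).+1)%N ->
  forall t : nat, (1 <= t <= s)%N ->
  forall v : {ffun 'I_n -> {mpoly 'Z_(p ^ s)[n]}},
    MfiltM n p s M t v <-> Mfilt n g p s t v.
Proof.
move=> p_pr p_odd _ nE _ s_gt0 _ dvdM t /andP[_ le_ts] v.
have dvdMr r : (r <= s)%N -> forall i, (p ^ r %| (2 * M i).+1)%N.
  by move=> le_rs i; apply: dvdn_trans (dvdM i); rewrite dvdn_exp2l.
apply: (iff_trans _ (spanned_Mfilt p_pr p_odd s_gt0 t v nE)).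
(* Each inclusion is checked on generators of level r, where p^r divides p^s and hence every 2 M_i +
   1. *)
split; apply: spanned_trans => r l c /andP[r_gt0 le_rt] l_gt0 qc.
  apply: spanned_Ipr => //; last by rewrite le_rt.
  exact: dvdMr (leq_trans le_rt le_ts).
apply: spanned_Ivec => //; last by rewrite r_gt0.
exact: dvdMr (leq_trans le_rt le_ts).
Qed.
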